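(* The series $\mathcal{VO}_d(z,q)$ and $\mathcal{XO}_d(z,q)$ belong to $\mathscr{T}_{z,q}^2$. In particular, for all integers $m,n\ge0$: $VO_d(m,n)>VO_d(m+2,n)$ provided $VO_d(m,n)\ne0$, and $XO_d(m,n)>XO_d(m+2,n)$ provided $XO_d(m,n)\ne0$.
   Context: $(a;q)_n=\prod_{0\le j<n}(1-aq^j)$ for $n\in\mathbb{N}_0\cup\{\infty\}$, $(a,b;q)_n=(a;q)_n(b;q)_n$. Define $$\mathcal{VO}_d(z,q)=\sum_{n\ge0}\sum_mVO_d(m,n)z^mq^n=\sum_{n\ge1}q^{2n-1}(-zq^{2n+1},-z^{-1}q^{2n+1};q^2)_\infty,$$ $$\mathcal{XO}_d(z,q)=\sum_{n\ge0}\sum_mXO_d(m,n)z^mq^n=\sum_{n\ge0}q^{2n+1}(-zq,-z^{-1}q;q^2)_n.$$ $\mathscr{T}_z^2$ is the set of Laurent polynomials $\sum_ic_iz^i$ with real $c_i\ge0$, $c_{-i}=c_i$, and for $r\in\{0,1\}$, $\ell\ge0$: $c_{r+2\ell}\ge c_{r+2(\ell+1)}$, strictly whenever $c_{r+2\ell}>0$; a series $\sum_nC_n(z)q^n$ lies in $\mathscr{T}_{z,q}^2$ if every $C_n(z)\in\mathscr{T}_z^2$. *)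

(* Defs.v *)
From HB Require Import structures.
From mathcomp Require Import all_boot all_order all_algebra finmap.
From mathcomp Require Import all_classical reals.
From mathcomp Require Import monalg.

Set Implicit Arguments.
Unset Strict Implicit.
Unset Printing Implicit Defensive.

Import Order.TTheory GRing.Theory Num.Theory.
Local Open Scope ring_scope.

(* [monalg] provides [{malg R[K]}] (finitely supported functions K -> R, with
   [C@_i] the coefficient of C at i) as a module for every choiceType [K], but
   as a ring only when [K] is a [monomType], i.e. when the unit of [K] has no
   nontrivial factorisation.  This excludes the additive group [int], so the
   convolution product is set up here, on a separate alias. *)

Definition laurent (R : comNzRingType) : Type := {malg R[int]}.

HB.instance Definition _ (R : comNzRingType) :=
  GRing.Lmodule.copy (laurent R) {malg R[int]}.

Section LaurentRing.
Variable R : comNzRingType.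
Implicit Types f g h : laurent R.
Local Open Scope fset_scope.

(* z ^ i, for any integer i *)
Definition lmon (i : int) : laurent R := << i >>.

Definition lmul f g : laurent R :=
  \sum_(i <- msupp f) \sum_(j <- msupp g) << f@_i * g@_j *g (i + j)%R >>.

Fact lmulw (d1 d2 : {fset int}) f g : msupp f `<=` d1 -> msupp g `<=` d2 ->
  lmul f g = \sum_(i <- d1) \sum_(j <- d2) << f@_i * g@_j *g (i + j)%R >>.
Proof.
move=> le_d1 le_d2; rewrite /lmul (big_fset_incl _ le_d1) /=.
  apply/eq_bigr=> i _; apply/big_fset_incl => // k _ /mcoeff_outdom ->.
  by rewrite mulr0 monalgU0.
move=> k _ /mcoeff_outdom fk.
by rewrite big1 => // k' _; rewrite fk mul0r monalgU0.
Qed.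

Fact lmulC : commutative lmul.
Proof.
move=> f g; rewrite /lmul exchange_big; apply: eq_bigr => i _.
by apply: eq_bigr => j _; rewrite mulrC addrC.
Qed.

Fact lmulUU a b i j :
  lmul << a *g i >> << b *g j >> = << a * b *g (i + j)%R >>.
Proof. by rewrite (lmulw msuppU_le msuppU_le) !big_seq_fset1 !mcoeffUU. Qed.

Fact lmulDl : left_distributive lmul +%R.
Proof.
move=> f1 f2 g; rewrite (lmulw (msuppD_le f1 f2) (fsubset_refl _)).
rewrite (lmulw (fsubsetUl _ (msupp f2)) (fsubset_refl _)).
rewrite (lmulw (fsubsetUr (msupp f1) _) (fsubset_refl _)).
rewrite -big_split /=; apply/eq_bigr=> i _.
rewrite -big_split /=; apply/eq_bigr=> j _.
by rewrite mcoeffD mulrDl monalgUD.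
Qed.

Fact lmulDr : right_distributive lmul +%R.
Proof. by move=> f g h; rewrite lmulC lmulDl !(lmulC f). Qed.

Fact lmul0l : left_zero 0 lmul.
Proof. by move=> f; rewrite /lmul msupp0 big_seq_fset0. Qed.

Fact lmul0r : right_zero 0 lmul.
Proof. by move=> f; rewrite lmulC lmul0l. Qed.

Fact lmul_suml (I : Type) (s : seq I) (F : I -> laurent R) g :
  lmul (\sum_(i <- s) F i) g = \sum_(i <- s) lmul (F i) g.
Proof. exact: (big_morph (lmul^~ g) (fun _ _ => lmulDl _ _ _) (lmul0l g)). Qed.

Fact lmul_sumr (I : Type) (s : seq I) (F : I -> laurent R) g :
  lmul g (\sum_(i <- s) F i) = \sum_(i <- s) lmul g (F i).
Proof. exact: (big_morph (lmul g) (fun _ _ => lmulDr _ _ _) (lmul0r g)). Qed.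

Fact lmulEl f g :
  lmul f g = \sum_(i <- msupp f) lmul << f@_i *g i >> g.
Proof. by rewrite [f in LHS](@monalgE int R) [LHS]lmul_suml. Qed.

Fact lmulEr f g :
  lmul f g = \sum_(i <- msupp g) lmul f << g@_i *g i >>.
Proof. by rewrite [g in LHS](@monalgE int R) [LHS]lmul_sumr. Qed.

Fact lmulA : associative lmul.
Proof.
move=> f g h; rewrite (lmulEl f (lmul g h)) (lmulEl f g) [RHS]lmul_suml.
apply: eq_bigr => i _; rewrite (lmulEl g h) [LHS]lmul_sumr.
rewrite (lmulEr _ g) [RHS]lmul_suml; apply: eq_bigr => j _.
rewrite (lmulEr _ h) [LHS]lmul_sumr (lmulEr _ h); apply: eq_bigr => k _.
by rewrite !lmulUU mulrA addrA.
Qed.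

Fact lmul1l : left_id (lmon 0) lmul.
Proof.
move=> f; rewrite [f](@monalgE int R) lmul_sumr; apply: eq_bigr => i _.
by rewrite lmulUU mul1r add0r.
Qed.

Fact lone_neq0 : lmon 0 != 0.
Proof. by rewrite monalgU_eq0 oner_eq0. Qed.

End LaurentRing.

HB.instance Definition _ (R : comNzRingType) :=
  GRing.Zmodule_isComNzRing.Build (laurent R)
    (@lmulA R) (@lmulC R) (@lmul1l R) (@lmulDl R) (@lone_neq0 R).

Record fps (A : Type) := Fps { fcoef : nat -> A }.

HB.instance Definition _ (A : Type) := gen_eqMixin (fps A).
HB.instance Definition _ (A : Type) := gen_choiceMixin (fps A).

Lemma fpsP (A : Type) (f g : fps A) : (forall n, fcoef f n = fcoef g n) -> f = g.
Proof. by case: f g => f [g] /= /funext ->. Qed.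

Section FpsRing.
Variable A : comNzRingType.
Implicit Types f g h : fps A.

Definition fps0 : fps A := Fps (fun=> 0).
Definition fps1 : fps A := Fps (fun n => (n == 0)%:R).
Definition fpsN f : fps A := Fps (fun n => - fcoef f n).
Definition fpsD f g : fps A := Fps (fun n => fcoef f n + fcoef g n).
Definition fpsM f g : fps A :=
  Fps (fun n => \sum_(i < n.+1) fcoef f i * fcoef g (n - i)%N).

Fact fpsDA : associative fpsD.
Proof. by move=> f g h; apply: fpsP => n /=; rewrite addrA. Qed.
Fact fpsDC : commutative fpsD.
Proof. by move=> f g; apply: fpsP => n /=; rewrite addrC. Qed.
Fact fpsD0 : left_id fps0 fpsD.
Proof. by move=> f; apply: fpsP => n /=; rewrite add0r. Qed.
Fact fpsDN : left_inverse fps0 fpsN fpsD.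
Proof. by move=> f; apply: fpsP => n /=; rewrite addNr. Qed.

HB.instance Definition _ :=
  GRing.isZmodule.Build (fps A) fpsDA fpsDC fpsD0 fpsDN.

Definition ftrunc N f : {poly A} := \poly_(i < N) fcoef f i.

Fact coef_ftruncM N f g n : (n < N)%N ->
  (ftrunc N f * ftrunc N g)`_n = fcoef (fpsM f g) n.
Proof.
move=> nN; rewrite coefM; apply: eq_bigr => i _; rewrite !coef_poly.
by rewrite (leq_ltn_trans (leq_subr _ _) nN) (leq_ltn_trans _ nN) // -ltnS.
Qed.

Fact ftruncMl N f (p : {poly A}) n : (n < N)%N ->
  (p * ftrunc N f)`_n = \sum_(i < n.+1) p`_i * fcoef f (n - i)%N.
Proof.
move=> nN; rewrite coefM; apply: eq_bigr => i _; rewrite coef_poly.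
by rewrite (leq_ltn_trans (leq_subr _ _) nN).
Qed.

Fact fpsMC : commutative fpsM.
Proof. by move=> f g; apply: fpsP => n; rewrite -!(@coef_ftruncM n.+1) // mulrC. Qed.

Fact fpsM3 f g h n :
  fcoef (fpsM (fpsM f g) h) n =
  (ftrunc n.+1 f * ftrunc n.+1 g * ftrunc n.+1 h)`_n.
Proof.
rewrite ftruncMl //; apply: eq_bigr => i _.
by rewrite coef_ftruncM.
Qed.

Fact fpsMA : associative fpsM.
Proof.
move=> f g h; apply: fpsP => n.
by rewrite (fpsMC f) !fpsM3 [ftrunc _ g * _ * _]mulrC mulrA.
Qed.

Fact fps1M : left_id fps1 fpsM.
Proof.
move=> f; apply: fpsP => n /=; rewrite big_ord_recl /= mul1r subn0.
by rewrite big1 ?addr0 // => i _; rewrite mul0r.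
Qed.

Fact fpsMDl : left_distributive fpsM +%R.
Proof.
move=> f g h; apply: fpsP => n /=; rewrite -big_split /=.
by apply: eq_bigr => i _; rewrite mulrDl.
Qed.

Fact fps1_neq0 : fps1 != 0.
Proof.
by apply/eqP => /(congr1 (fun f => fcoef f 0)) /= /eqP; rewrite oner_eq0.
Qed.

HB.instance Definition _ :=
  GRing.Zmodule_isComNzRing.Build (fps A) fpsMA fpsMC fps1M fpsMDl fps1_neq0.

Definition fpsC (c : A) : fps A := Fps (fun n => if n == 0 then c else 0).
Definition fpsX : fps A := Fps (fun n => (n == 1)%:R).

Lemma fcoefD f g n : fcoef (f + g) n = fcoef f n + fcoef g n.
Proof. by []. Qed.
Lemma fcoefN f n : fcoef (- f) n = - fcoef f n.
Proof. by []. Qed.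
Lemma fcoefM f g n :
  fcoef (f * g) n = \sum_(i < n.+1) fcoef f i * fcoef g (n - i)%N.
Proof. by []. Qed.

Lemma fcoef_sum (I : Type) (s : seq I) (P : pred I) (F : I -> fps A) n :
  fcoef (\sum_(i <- s | P i) F i) n = \sum_(i <- s | P i) fcoef (F i) n.
Proof. exact: (big_morph (fun f => fcoef f n)). Qed.

Lemma fcoefXn k n : fcoef (fpsX ^+ k) n = (n == k)%:R.
Proof.
elim: k n => [|k IHk] n; first by [].
rewrite exprS fcoefM; case: n => [|n].
  by rewrite big_ord1 /= mul0r.
rewrite big_ord_recl /= mul0r add0r big_ord_recl /= mul1r.
by rewrite subSS subn0 IHk big1 ?addr0 // => i _; rewrite mul0r.
Qed.

Lemma fcoefXnM k f n :
  fcoef (fpsX ^+ k * f) n = if (n < k)%N then 0 else fcoef f (n - k)%N.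
Proof.
rewrite fcoefM; case: ltnP => [nk|kn].
  rewrite big1 // => i _; rewrite fcoefXn ltn_eqF ?mul0r //.
  by apply: leq_ltn_trans nk; rewrite -ltnS.
have kn1 : (k < n.+1)%N by [].
rewrite (bigD1 (Ordinal kn1)) //= fcoefXn eqxx mul1r big1 ?addr0 // => i /eqP ik.
rewrite fcoefXn; case: eqP => [e|]; last by rewrite mul0r.
by case: ik; apply: val_inj.
Qed.

(* convergence for the q-adic topology: the coefficient of each q^n, here a
   whole Laurent polynomial, is eventually constant *)
Definition qcvg (u : nat -> fps A) (f : fps A) : Prop :=
  forall n, exists N0, forall N, (N0 <= N)%N -> fcoef (u N) n = fcoef f n.

(* the limit of u, and 0 if u does not converge *)
Definition qlim (u : nat -> fps A) : fps A := xget 0 [set f | qcvg u f].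

Lemma qcvg_unique u f g : qcvg u f -> qcvg u g -> f = g.
Proof.
move=> uf ug; apply: fpsP => n.
have [N1 h1] := uf n; have [N2 h2] := ug n.
by rewrite -(h1 (maxn N1 N2)) ?leq_maxl // h2 ?leq_maxr.
Qed.

Lemma qlimE u f : qcvg u f -> qlim u = f.
Proof.
by move=> uf; apply: xget_unique => // g ug; apply: qcvg_unique ug uf.
Qed.

Lemma qcvg_qlim u :
  (forall n N, (n < N)%N -> fcoef (u N.+1) n = fcoef (u N) n) -> qcvg u (qlim u).
Proof.
move=> st; pose f := Fps (fun n => fcoef (u n.+1) n).
suff uf : qcvg u f by rewrite (qlimE uf).
move=> n; exists n.+1 => N /subnK <-; elim: (N - n.+1)%N => // k IHk.
by rewrite addSn st // ltn_addl.
Qed.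

Definition qpoch (a q : fps A) (n : nat) : fps A :=
  \prod_(0 <= j < n) (1 - a * q ^+ j).
Definition qpoch_inf (a q : fps A) : fps A := qlim (qpoch a q).
Definition qpoch2 (a b q : fps A) (n : nat) : fps A := qpoch a q n * qpoch b q n.
Definition qpoch2_inf (a b q : fps A) : fps A := qpoch_inf a q * qpoch_inf b q.

Lemma qpochS a q n : qpoch a q n.+1 = qpoch a q n * (1 - a * q ^+ n).
Proof. by rewrite /qpoch big_nat_recr. Qed.

Lemma qpoch_infP a k : (0 < k)%N ->
  qcvg (qpoch a (fpsX ^+ k)) (qpoch_inf a (fpsX ^+ k)).
Proof.
move=> k0; apply: qcvg_qlim => n N nN; rewrite qpochS.
rewrite mulrBr mulr1 -exprM mulrA [_ * fpsX ^+ _]mulrC fcoefD fcoefN fcoefXnM.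
by rewrite (leq_trans nN) ?leq_pmull // subr0.
Qed.

End FpsRing.

Section Series.
Variable R : realType.

Definition qvar : fps (laurent R) := fpsX (laurent R).
Definition zvar : fps (laurent R) := fpsC (lmon R 1).
Definition zinv : fps (laurent R) := fpsC (lmon R (- 1)).

Local Notation q := qvar.
Local Notation z := zvar.
Local Notation zV := zinv.

Definition VO_partial (N : nat) : fps (laurent R) :=
  \sum_(1 <= n < N) q ^+ (2 * n - 1) *
    qpoch2_inf (- z * q ^+ (2 * n + 1)) (- zV * q ^+ (2 * n + 1)) (q ^+ 2).
Definition VO_series : fps (laurent R) := qlim VO_partial.

Definition XO_partial (N : nat) : fps (laurent R) :=
  \sum_(0 <= n < N) q ^+ (2 * n + 1) * qpoch2 (- z * q) (- zV * q) (q ^+ 2) n.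
Definition XO_series : fps (laurent R) := qlim XO_partial.

Lemma mulzV : z * zV = 1.
Proof.
apply: fpsP => -[|n]; rewrite fcoefM.
  by rewrite big_ord1 /= [LHS]lmulUU mul1r.
rewrite big1 // => -[[|i] Hi] _ /=; [exact: mulr0 | exact: mul0r].
Qed.

Lemma VO_seriesP : qcvg VO_partial VO_series.
Proof.
apply: qcvg_qlim => n N nN; rewrite /VO_partial big_nat_recr ?(leq_trans _ nN) //.
rewrite fcoefD fcoefXnM ifT ?addr0 //.
apply: (leq_trans nN); rewrite leq_subRL mul2n -addnn.
  by rewrite leq_add2r (leq_trans _ nN).
by rewrite (leq_trans _ (leq_addr _ _)) // (leq_trans _ nN).
Qed.

Lemma XO_seriesP : qcvg XO_partial XO_series.
Proof.
apply: qcvg_qlim => n N nN; rewrite /XO_partial big_nat_recr //.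
rewrite fcoefD fcoefXnM ifT ?addr0 //.
by apply: (leq_trans nN); rewrite mul2n -addnn -addnA leq_addr.
Qed.

Definition VO_d (m : int) (n : nat) : R := (fcoef VO_series n)@_m.
Definition XO_d (m : int) (n : nat) : R := (fcoef XO_series n)@_m.

Definition Tz2 (C : laurent R) : Prop :=
  [/\ forall i : int, 0 <= C@_i,
      forall i : int, C@_(- i)%R = C@_i
    & forall r l : nat, (r < 2)%N ->
        C@_((r + 2 * l.+1)%N%:Z) <= C@_((r + 2 * l)%N%:Z) /\
        (0 < C@_((r + 2 * l)%N%:Z) ->
         C@_((r + 2 * l.+1)%N%:Z) < C@_((r + 2 * l)%N%:Z))].

Definition Tzq2 (f : fps (laurent R)) : Prop := forall n, Tz2 (fcoef f n).

End Series.

(* Main.v *)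
(* Since [(1 + z q^a) (1 + z^-1 q^a) = 1 + q^(2a) + q^a (z + z^-1)], all the
   coefficients in q are nonnegative combinations of characters of sl_2, where
   [z + z^-1] is the character of the standard representation; thus
   [c_k - c_(k+2)], the multiplicity of the k-th character, is nonnegative.
   For strictness, the exponents n for which [z^k q^n] can occur in the product
   over [a = b, b + 2, b + 4, ...] are [k b + k (k - 1) + 2 t], and the k-th
   character does occur there, except that the shift t may have to be absorbed
   by passing to another summand of the series. *)
Require Import Defs.
From HB Require Import structures.
From mathcomp Require Import all_boot all_order all_algebra finmap.
From mathcomp Require Import all_classical reals.
From mathcomp Require Import monalg zify ring.

Set Implicit Arguments.
Unset Strict Implicit.
Unset Printing Implicit Defensive.

Import Order.TTheory GRing.Theory Num.Theory.
Local Open Scope ring_scope.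

(** * Limits of products, and the recursion for the finite products *)

Lemma mcoeff_lmonM (R : comNzRingType) (i : int) (C : laurent R) (k : int) :
  (lmon R i * C)@_k = C@_(k - i).
Proof.
rewrite [C](@monalgE int R) [lmon R i * _]lmul_sumr !raddf_sum /=.
apply: eq_bigr => j _; rewrite /lmon lmulUU mul1r !mcoeffU.
by congr (_ *+ nat_of_bool _); apply/eqP/eqP; lia.
Qed.

Lemma fcoefCM (A : comNzRingType) (c : A) (f : fps A) (n : nat) :
  fcoef (fpsC c * f) n = c * fcoef f n.
Proof.
rewrite fcoefM big_ord_recl /= subn0 big1 ?addr0 // => i _.
exact: mul0r.
Qed.

Section Convergence.
Context {A : comNzRingType}.
Implicit Types (u v : nat -> fps A) (f g : fps A).

(** The n-th coefficient of a product involves all coefficients up to n, so they must stabilise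
    together. *)
Lemma qcvg_upto u f (n : nat) : qcvg u f ->
  exists N0, forall N i, (N0 <= N)%N -> (i <= n)%N ->
    fcoef (u N) i = fcoef f i.
Proof.
move=> uf; elim: n => [|n [N1 h1]].
  by have [N0 h0] := uf 0; exists N0 => N i NN; rewrite leqn0 => /eqP ->; exact: h0.
have [N2 h2] := uf n.+1; exists (maxn N1 N2) => N i; rewrite geq_max => /andP[l1 l2].
rewrite leq_eqVlt => /orP[/eqP -> | ]; [exact: h2 | exact: h1].
Qed.

Lemma qcvgM u v f g :
  qcvg u f -> qcvg v g -> qcvg (fun N => u N * v N) (f * g).
Proof.
move=> uf vg n; have [N1 h1] := qcvg_upto n uf; have [N2 h2] := qcvg_upto n vg.
exists (maxn N1 N2) => N; rewrite geq_max => /andP[l1 l2].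
rewrite !fcoefM; apply: eq_bigr => i _.
by rewrite h1 // ?h2 ?leq_subr // -ltnS.
Qed.

Lemma qpoch0 (a q : fps A) : qpoch a q 0 = 1.
Proof. exact: big_geq. Qed.

Lemma qpoch2S (z zV q : fps A) (b M : nat) : z * zV = 1 ->
  let P := qpoch2 (- z * q ^+ b) (- zV * q ^+ b) (q ^+ 2) in
  P M.+1 = P M + q ^+ (2 * (b + 2 * M)) * P M
    + q ^+ (b + 2 * M) * ((z + zV) * P M).
Proof.
move=> zzV /=; rewrite /qpoch2 !qpochS [(2 * (_ + _))%N]mulnC.
rewrite [q ^+ (_ * 2)]exprM [q ^+ (b + 2 * M)]exprD [q ^+ (2 * M)]exprM.
(* After generalisation [x * y] stands for q^(b + 2M), and [z * zV = 1] is the only fact used beyond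
   the ring axioms. *)
move: (qpoch (- z * _) _ _) (qpoch (- zV * _) _ _) => P Q.
move: (q ^+ b) ((q ^+ 2) ^+ M) => x y.
transitivity (P * Q * (1 + (z * zV) * (x * y) ^+ 2 + x * y * (z + zV))).
  by ring.
by rewrite zzV; ring.
Qed.

Lemma fcoef_qpoch2S (z zV : fps A) (c : A) (b M n : nat) :
  z * zV = 1 -> z + zV = fpsC c ->
  let q := fpsX A in
  let P := qpoch2 (- z * q ^+ b) (- zV * q ^+ b) (q ^+ 2) in
  let a := (b + 2 * M)%N in
  fcoef (P M.+1) n = fcoef (P M) n
    + (if (n < 2 * a)%N then 0 else fcoef (P M) (n - 2 * a))
    + (if (n < a)%N then 0 else c * fcoef (P M) (n - a)).
Proof.
move=> zzV zD q P a; have -> : P M.+1 = _ := qpoch2S q b M zzV.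
by rewrite zD !fcoefD !fcoefXnM fcoefCM.
Qed.

End Convergence.

(** * Characters of sl_2 and their multiplicities in the finite products *)

Section Characters.
Context {R : realType}.
Implicit Types (C D : laurent R) (n k b M : nat).

(* The Laurent polynomials satisfying this are the nonnegative combinations of
   the characters [z^k + z^(k-2) + ... + z^(-k)] of sl_2; [mult k C] is the
   coefficient of the k-th character. *)
Definition mult k C : R := C@_(k%:Z) - C@_((k + 2)%N%:Z).

Definition sl2char C : Prop :=
  [/\ forall i : int, 0 <= C@_i, forall i : int, C@_(- i)%R = C@_i
    & forall k, 0 <= mult k C].

Lemma multD k C D : mult k (C + D) = mult k C + mult k D.
Proof. by rewrite /mult !mcoeffD opprD addrACA. Qed.

Lemma mult_lerDl k C C' D1 D2 : C' = C + D1 + D2 ->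
  0 <= mult k D1 -> 0 <= mult k D2 -> mult k C <= mult k C'.
Proof. by move=> -> D1k D2k; rewrite !multD -addrA lerDl addr_ge0. Qed.

Lemma sl2char0 : sl2char 0.
Proof. by split=> [i|i|k]; rewrite /mult ?mcoeff0 ?subrr. Qed.

Lemma sl2charD C D : sl2char C -> sl2char D -> sl2char (C + D).
Proof.
move=> [C0 Cs Cm] [D0 Ds Dm]; split=> [i|i|k].
- by rewrite mcoeffD addr_ge0.
- by rewrite !mcoeffD Cs Ds.
- by rewrite multD addr_ge0.
Qed.

Definition chi : laurent R := lmon R 1 + lmon R (- 1).

Lemma mcoeff_chiM C (i : int) : (chi * C)@_i = C@_(i - 1) + C@_(i + 1).
Proof. by rewrite mulrDl mcoeffD !mcoeff_lmonM opprK. Qed.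

(** This and [mult_chiMS] are the Clebsch-Gordan rule: [chi] times the k-th character is the sum of
    the characters k - 1 and k + 1. At 0 the lower neighbour drops out because the coefficients at
    -1 and 1 agree. *)
Lemma mult_chiM0 C : sl2char C -> mult 0 (chi * C) = mult 1 C.
Proof.
move=> [_ Cs _]; rewrite /mult !mcoeff_chiM.
rewrite (_ : 0%N%:Z - 1 = - 1) // (_ : 0%N%:Z + 1 = 1) // Cs.
rewrite (_ : (0 + 2)%N%:Z - 1 = 1) // (_ : (0 + 2)%N%:Z + 1 = (1 + 2)%N%:Z) //.
by rewrite opprD addrACA subrr add0r.
Qed.

Lemma mult_chiMS k C : mult k.+1 (chi * C) = mult k C + mult k.+2 C.
Proof.
rewrite /mult !mcoeff_chiM.
rewrite (_ : k.+1%:Z - 1 = k) 1?(_ : k.+1%:Z + 1 = k.+2); try lia.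
rewrite (_ : (k.+1 + 2)%N%:Z - 1 = (k + 2)%N) 1?(_ : (k.+1 + 2)%N%:Z + 1 = (k.+2 + 2)%N); try lia.
by rewrite opprD addrACA.
Qed.

Lemma sl2char_chiM C : sl2char C -> sl2char (chi * C).
Proof.
move=> cC; have [C0 Cs Cm] := cC; split=> [i|i|[|k]].
- by rewrite mcoeff_chiM addr_ge0.
- rewrite !mcoeff_chiM (_ : - i - 1 = - (i + 1)) 1?(_ : - i + 1 = - (i - 1)); try lia.
  by rewrite !Cs addrC.
- by rewrite mult_chiM0.
- by rewrite mult_chiMS addr_ge0.
Qed.

Lemma mult_chiM_ge k C : sl2char C -> mult k C <= mult k.+1 (chi * C).
Proof. by move=> [_ _ Cm]; rewrite mult_chiMS lerDl. Qed.

Lemma sl2char1 : sl2char 1.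
Proof.
split=> [i|i|k]; rewrite /mult /GRing.one /= /lmon !mcoeffU.
- by rewrite ler0n.
- by congr (_ *+ nat_of_bool _); apply/eqP/eqP; lia.
- by rewrite addn2 subr0 ler0n.
Qed.

Lemma mult_sum k (m N : nat) (C : nat -> laurent R) :
  mult k (\sum_(m <= i < N) C i) = \sum_(m <= i < N) mult k (C i).
Proof.
apply: (big_morph (mult k) (multD k)).
by rewrite /mult !mcoeff0 subrr.
Qed.

(** Multiplicities are nonnegative and add up, so one positive multiplicity makes the inequality
    strict; it may come from a summand [j] other than the [i] where the coefficient occurs. *)
Lemma Tz2_sum (m N : nat) (C : nat -> laurent R) :
  (forall i, sl2char (C i)) ->
  (forall i k, (m <= i < N)%N -> (C i)@_(k%:Z) != 0 ->
     exists2 j, (m <= j < N)%N & 0 < mult k (C j)) ->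
  Tz2 (\sum_(m <= i < N) C i).
Proof.
move=> charC strictC.
have [S0 Ss Sm] : sl2char (\sum_(m <= i < N) C i).
  by apply: big_ind => //; [exact: sl2char0 | exact: sl2charD].
split=> // r l _; have -> : (r + 2 * l.+1 = r + 2 * l + 2)%N by lia.
move: (r + 2 * l)%N => k; split=> [|]; first by rewrite -subr_ge0 Sm.
rewrite raddf_sum /= => Ck.
have [i imN Cik] : exists2 i, (m <= i < N)%N & (C i)@_(k%:Z) != 0.
  apply/not_exists2P => C0; move: Ck; rewrite big_nat big1 ?ltxx // => i imN.
  by apply/eqP; case: (C0 i) => // /negP; rewrite negbK.
have [j jmN multj] := strictC _ _ imN Cik.
rewrite -raddf_sum -subr_gt0 -/(mult _ _) mult_sum.
rewrite (bigD1_seq j) ?mem_index_iota ?iota_uniq //= ltr_pwDl //.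
by apply: sumr_ge0 => i' _; have [_ _] := charC i'.
Qed.

Definition theta b M : fps (laurent R) :=
  qpoch2 (- zvar R * qvar R ^+ b) (- zinv R * qvar R ^+ b) (qvar R ^+ 2) M.

Lemma theta0 b : theta b 0 = 1.
Proof. by rewrite /theta /qpoch2 !qpoch0; exact: mulr1. Qed.

Lemma sl2char_if (c : bool) C : sl2char C -> sl2char (if c then 0 else C).
Proof. by case: c => // _; exact: sl2char0. Qed.

Lemma fcoef_thetaS b M n : let a := (b + 2 * M)%N in
  fcoef (theta b M.+1) n = fcoef (theta b M) n
    + (if (n < 2 * a)%N then 0 else fcoef (theta b M) (n - 2 * a))
    + (if (n < a)%N then 0 else chi * fcoef (theta b M) (n - a)).
Proof.
have zD : zvar R + zinv R = fpsC chi.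
  by apply: fpsP => -[|i] //=; rewrite addr0.
exact (fcoef_qpoch2S b M n (mulzV R) zD).
Qed.

(** [M] is left out so that rewriting works under a sum over [M] and on [theta b] as a sequence. *)
Lemma thetaE b : theta b =
  qpoch2 (- zvar R * qvar R ^+ b) (- zinv R * qvar R ^+ b) (qvar R ^+ 2).
Proof. by []. Qed.

Lemma sl2char_theta b M n : sl2char (fcoef (theta b M) n).
Proof.
elim: M n => [|M IHM] n.
  by rewrite theta0; case: n => [|n]; [exact: sl2char1 | exact: sl2char0].
rewrite fcoef_thetaS; apply: sl2charD.
  by apply: sl2charD => //; exact: sl2char_if.
by apply: sl2char_if; exact: sl2char_chiM.
Qed.

Lemma mult_theta_ge0 b M n k : 0 <= mult k (fcoef (theta b M) n).
Proof. by have [_ _] := sl2char_theta b M n. Qed.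

(** The cheapest way to reach z^k takes z q^a from the first k factors, at cost kb + k(k - 1); any
    other way costs an even amount more, as all a are congruent to b mod 2. Adding k to n avoids a
    subtraction. *)
Lemma theta_support b M n k : (fcoef (theta b M) n)@_(k%:Z) != 0 ->
  (k <= M)%N /\ exists t, (n + k = k * b + k * k + 2 * t)%N.
Proof.
elim: M n k => [|M IHM] n k.
  rewrite theta0 /= /GRing.one /= /lmon; case: n => [|n]; last by rewrite mcoeff0 eqxx.
  rewrite mcoeffU; case: k => [|k]; last by rewrite eqxx.
  by move=> _; split=> //; exists 0.
rewrite fcoef_thetaS; set a := (b + 2 * M)%N; rewrite !mcoeffD => nz.
have : [\/ (fcoef (theta b M) n)@_(k%:Z) != 0,
    (2 * a <= n)%N /\ (fcoef (theta b M) (n - 2 * a))@_(k%:Z) != 0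
  | (a <= n)%N /\ (chi * fcoef (theta b M) (n - a))@_(k%:Z) != 0].
  move: nz; case: (ltnP n (2 * a)) => l1; case: (ltnP n a) => l2; rewrite ?mcoeff0 ?addr0.
  - by constructor 1.
  - have [->|] := eqVneq (fcoef (theta b M) n)@_(k%:Z) 0; last by constructor 1.
    by rewrite add0r; constructor 3.
  - lia.
  have [->|] := eqVneq (fcoef (theta b M) n)@_(k%:Z) 0; last by constructor 1.
  have [->|] := eqVneq (fcoef (theta b M) (n - 2 * a))@_(k%:Z) 0; last by constructor 2.
  by rewrite !add0r; constructor 3.
clear nz; case=> [/IHM[kM [t e]]|[an /IHM[kM [t e]]]|[an]].
- by split; [exact: ltnW | exists t].
- by split; [exact: ltnW | exists (t + a)%N; lia].
have up : (fcoef (theta b M) (n - a))@_(k.+1%:Z) != 0 ->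
    (k <= M.+1)%N /\ exists t, (n + k = k * b + k * k + 2 * t)%N.
  move=> /IHM[kM [t e]]; split; first by lia.
  by exists (k + t + b + M)%N; move: e; rewrite /a !mulSn !mulnS; lia.
rewrite mcoeff_chiM (_ : k%:Z + 1 = k.+1); last by lia.
have [->|/up//] := eqVneq (fcoef (theta b M) (n - a))@_(k.+1%:Z) 0.
rewrite addr0; case: k up => [|k] up.
  by rewrite (_ : 0%N%:Z - 1 = - 1) //; have [_ -> _] := sl2char_theta b M (n - a); exact: up.
rewrite (_ : k.+1%:Z - 1 = k); last by lia.
move=> /IHM[kM [t e]]; split=> //.
(* The last factor costs b + 2M where the one of index k would cost b + 2k; [k <= M] makes the
   excess nonnegative. *)
by exists (t + (M - k))%N; move: e; rewrite /a !mulSn !mulnS; lia.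
Qed.

Lemma mult_theta_monoS b M n k :
  mult k (fcoef (theta b M) n) <= mult k (fcoef (theta b M.+1) n).
Proof.
apply: (mult_lerDl (fcoef_thetaS b M n)).
  have [_ _] := sl2char_if (n < 2 * (b + 2 * M))%N
    (sl2char_theta b M (n - 2 * (b + 2 * M))); exact.
have [_ _] := sl2char_if (n < b + 2 * M)%N
  (sl2char_chiM (sl2char_theta b M (n - (b + 2 * M)))); exact.
Qed.

Lemma mult_theta_mono b M M' n k : (M <= M')%N ->
  mult k (fcoef (theta b M) n) <= mult k (fcoef (theta b M') n).
Proof.
move=> /subnKC <-; elim: (M' - M)%N => [|d IHd]; first by rewrite addn0.
by rewrite addnS (le_trans IHd) ?mult_theta_monoS.
Qed.

(** The q^a [chi] term of the last factor, with a = b + 2M, turns each k-th character into a (k +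
    1)-st one, by Clebsch-Gordan. *)
Lemma mult_theta_raise b M n k :
  mult k (fcoef (theta b M) n)
    <= mult k.+1 (fcoef (theta b M.+1) (n + (b + 2 * M))).
Proof.
have := fcoef_thetaS b M (n + (b + 2 * M)).
rewrite /= [if (n + _ < b + 2 * M)%N then _ else _]ifN ?addnK; last by lia.
rewrite [X in _ = X]addrC addrA => e.
apply: le_trans (mult_chiM_ge k (sl2char_theta b M n)) (mult_lerDl e _ _).
  exact: mult_theta_ge0.
have [_ _] := sl2char_if (n + (b + 2 * M) < 2 * (b + 2 * M))%N
  (sl2char_theta b M (n + (b + 2 * M) - 2 * (b + 2 * M))); exact.
Qed.

(* The k-th character occurs at [q^(kb + k(k-1))] by taking the [chi] terms of
   the first k factors; delaying the last of them by t factors adds 2t to the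
   exponent.  These are all the exponents allowed by [theta_support]. *)
Lemma mult_theta_gt0 b M n k t : (n + k = k * b + k * k + 2 * t)%N ->
  (0 < k)%N || (t == 0) -> (k + t <= M)%N -> 0 < mult k (fcoef (theta b M) n).
Proof.
elim: k M n t => [|k IHk] M n t e.
  move=> /= /eqP t0 _; have -> : n = 0 by lia.
  apply: lt_le_trans (mult_theta_mono _ _ _ (leq0n M)).
  rewrite theta0 /mult /GRing.one /= /lmon !mcoeffU /= subr0.
  exact: ltr01.
move=> _ ktM; have [n' en] : exists n', (n = n' + (b + 2 * (k + t)))%N.
  have kk : (k <= k * k)%N by nia.
  by exists (n - (b + 2 * (k + t)))%N; move: e; rewrite !mulSn !mulnS; lia.
apply: lt_le_trans (mult_theta_mono _ _ _ ktM).
rewrite addSn en; apply: lt_le_trans (mult_theta_raise _ _ _ _).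
apply: IHk (0%N) _ _ _; [|by rewrite orbT|by lia].
by move: e; rewrite en !mulSn !mulnS; lia.
Qed.

End Characters.

(** * Strictness for the two series *)

Section Series.
Context {R : realType}.
Implicit Types (n k b m : nat).

(** The bounds depend on the exponent of q because each coefficient of a q-adic limit has its own
    truncation. Summand [j] may replace [i] when both reach the same total exponent. *)
Lemma Tzq2_sum (m N : nat -> nat) (P : nat -> fps (laurent R))
    (s : nat -> nat) (S : fps (laurent R)) :
  (forall n, fcoef S n =
     \sum_(m n <= i < N n) fcoef (fpsX _ ^+ s i * P i) n) ->
  (forall i n, sl2char (fcoef (P i) n)) ->
  (forall i n k, (m (n + s i) <= i < N (n + s i))%N ->
     (fcoef (P i) n)@_(k%:Z) != 0 ->
     exists j n', [/\ (m (n + s i) <= j < N (n + s i))%N,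
       (n' + s j = n + s i)%N & 0 < mult k (fcoef (P j) n')]) ->
  Tzq2 S.
Proof.
move=> SE charP strictP n; rewrite SE; apply: Tz2_sum => [i|i k].
  by rewrite fcoefXnM; exact: sl2char_if.
rewrite fcoefXnM; case: (ltnP n (s i)) => [_ _|sn imN]; first by rewrite mcoeff0 eqxx.
move: imN; rewrite -{1 2}(subnK sn) => imN /(strictP _ _ _ imN).
rewrite subnK // => -[j [n' [jmN en multj]]]; exists j => //.
by rewrite fcoefXnM ifN -en ?addnK // -leqNgt leq_addl.
Qed.

(** The bound [n < N] leaves room for the shift of the summation index in [Tzq2_XO]. *)
Lemma XO_seriesE n : exists N, (n < N)%N /\ fcoef (XO_series R) n =
  \sum_(0 <= i < N) fcoef (fpsX _ ^+ (2 * i + 1) * theta 1 i) n.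
Proof.
have [N h] := XO_seriesP R n; exists (maxn N n.+1); split; first exact: leq_maxr.
rewrite -(h (maxn N n.+1)) ?leq_maxl // /XO_partial fcoef_sum.
by rewrite thetaE.
Qed.

Lemma Tzq2_XO : Tzq2 (XO_series R).
Proof.
have [N NE] := choice XO_seriesE.
apply: (@Tzq2_sum (fun=> 0) N (theta 1) (fun i => 2 * i + 1)%N).
- by move=> n; have [] := NE n.
- exact: sl2char_theta.
(* With only i factors there may be no room to delay by t. Summand i + t has a prefactor larger by
   q^(2t), which leaves the minimal exponent k^2 for its product. *)
move=> i n k _ /theta_support[ki [t e]]; exists (i + t)%N, (n - 2 * t)%N; split.
- by have [+ _] := NE (n + (2 * i + 1))%N; lia.
- by lia.
by apply: (@mult_theta_gt0 _ _ _ _ _ 0); lia.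
Qed.

Definition theta_inf b : fps (laurent R) :=
  qpoch2_inf (- zvar R * qvar R ^+ b) (- zinv R * qvar R ^+ b) (qvar R ^+ 2).

Lemma theta_infP b : qcvg (theta b) (theta_inf b).
Proof. rewrite thetaE; apply: qcvgM; exact: qpoch_infP. Qed.

(** The lower bound [m] provides the k + t factors that [mult_theta_gt0] requires. *)
Lemma fcoef_theta_inf b n m : exists2 M, (m <= M)%N &
  fcoef (theta_inf b) n = fcoef (theta b M) n.
Proof.
have [M h] := theta_infP b n; exists (maxn M m); first exact: leq_maxr.
by rewrite h ?leq_maxl.
Qed.

Lemma sl2char_theta_inf b n : sl2char (fcoef (theta_inf b) n).
Proof. by have [M _ ->] := fcoef_theta_inf b n 0; exact: sl2char_theta. Qed.

Lemma theta_inf_support b n k : (fcoef (theta_inf b) n)@_(k%:Z) != 0 ->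
  exists t, (n + k = k * b + k * k + 2 * t)%N.
Proof. by have [M _ ->] := fcoef_theta_inf b n 0; case/theta_support. Qed.

Lemma mult_theta_inf_gt0 b n k t : (n + k = k * b + k * k + 2 * t)%N ->
  (0 < k)%N || (t == 0) -> 0 < mult k (fcoef (theta_inf b) n).
Proof.
have [M ktM ->] := fcoef_theta_inf b n (k + t) => e kt.
exact: mult_theta_gt0 e kt ktM.
Qed.

Lemma VO_seriesE n : exists N, (n < N)%N /\ fcoef (VO_series R) n =
  \sum_(1 <= i < N) fcoef (fpsX _ ^+ (2 * i - 1) * theta_inf (2 * i + 1)) n.
Proof.
have [N h] := VO_seriesP R n; exists (maxn N n.+1); split; first exact: leq_maxr.
by rewrite -(h (maxn N n.+1)) ?leq_maxl // /VO_partial fcoef_sum.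
Qed.

Lemma Tzq2_VO : Tzq2 (VO_series R).
Proof.
have [N NE] := choice VO_seriesE.
apply: (@Tzq2_sum (fun=> 1) N (fun i => theta_inf (2 * i + 1))
  (fun i => 2 * i - 1)%N).
- by move=> n; have [] := NE n.
- by move=> i n; exact: sl2char_theta_inf.
(* For positive k the infinite product has room for every delay, so summand i itself serves. For k =
   0 there is no factor to delay: n = 2t is absorbed by the prefactor of summand i + t, whose
   product contributes its constant term 1. *)
move=> i n [|k] iN /theta_inf_support[t e]; last first.
  by exists i, n; split=> //; exact: mult_theta_inf_gt0 e _.
exists (i + t)%N, 0; split; [|lia|].
  by have [+ _] := NE (n + (2 * i - 1))%N; lia.
exact: (@mult_theta_inf_gt0 _ _ _ 0).
Qed.

Lemma Tz2_gt (C : laurent R) m : Tz2 C -> C@_(m%:Z) <> 0 ->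
  C@_((m + 2)%N%:Z) < C@_(m%:Z).
Proof.
move=> [C0 _ Cm] /eqP Cne0; have [_] := Cm (odd m) m./2 (ltac:(by case: (odd m))).
rewrite mulnS addnCA [(2 + _)%N]addnC mul2n odd_double_half; apply.
by rewrite lt_def Cne0 C0.
Qed.

End Series.

Theorem theorem4p9 (R : realType) :
  [/\ Tzq2 (VO_series R),
      Tzq2 (XO_series R),
      forall m n : nat,
        VO_d R m%:Z n <> 0 -> VO_d R m%:Z n > VO_d R (m + 2)%N%:Z n
    & forall m n : nat,
        XO_d R m%:Z n <> 0 -> XO_d R m%:Z n > XO_d R (m + 2)%N%:Z n].
Proof.
split; [exact: Tzq2_VO | exact: Tzq2_XO | |] => m n; apply: Tz2_gt.
  exact: Tzq2_VO.
exact: Tzq2_XO.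
Qed.
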